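(* Let $d\geq 2$, let $\mathcal{P}$ be a finite classical polar space of rank $d+2$ with parameter $e\leq 1$ over $\mathbb{F}_q$ naturally embedded in $\mathrm{PG}(n+3,q)$, and let $\alpha\cong\mathrm{PG}(n,q)$ be an $(n+1)$-dimensional (vector dimension) subspace of $\mathrm{PG}(n+3,q)$ that intersects $\mathcal{P}$ in a polar space $\mathcal{P}'$ of rank $d$ with parameter $e+1$. Thus one of the following holds: $n=2d$, $\mathcal{P}=\mathcal{Q}^+(2d+3,q)$, $\mathcal{P}'=\mathcal{Q}(2d,q)$; or $n=2d$, $q$ is a square, $\mathcal{P}=\mathcal{H}(2d+3,q)$, $\mathcal{P}'=\mathcal{H}(2d,q)$; or $n=2d+1$, $\mathcal{P}=\mathcal{Q}(2d+4,q)$, $\mathcal{P}'=\mathcal{Q}^-(2d+1,q)$. Let $\mathcal{M}$ be a regular $(m,d-1)$-ovoid of type $1$ in $\mathcal{P}'$, and let $\mathcal{L}$ be the set of generators of $\mathcal{P}$ that meet $\alpha$ in a subspace of dimension $d-1$ which is an element of $\mathcal{M}$. If $\mathcal{M}$ does not contain the set of generators of an embedded polar space of rank $d-1$ and parameter $e+2$ inside $\mathcal{P}'$, then $\mathcal{L}$ does not contain a point-pencil of $\mathcal{P}$.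
   Context: All dimensions are vector space dimensions; an $a$-space is a totally isotropic (totally singular) subspace of dimension $a$. The finite classical polar spaces of rank $D$ over $\mathbb{F}_q$ are the hyperbolic quadric $\mathcal{Q}^+(2D-1,q)$, the Hermitian space $\mathcal{H}(2D-1,q)$ ($q$ a square), the symplectic space $\mathcal{W}(2D-1,q)$, the parabolic quadric $\mathcal{Q}(2D,q)$, the Hermitian space $\mathcal{H}(2D,q)$ ($q$ a square) and the elliptic quadric $\mathcal{Q}^-(2D+1,q)$, with parameter $e=0,\tfrac12,1,1,\tfrac32,2$ respectively; the first number in parentheses is the projective dimension of the ambient space. Generators are the $D$-spaces; through each $(D-1)$-space there are $q^e+1$ generators. $\Omega_a$ denotes the set of $a$-spaces, $\boldsymbol{j}$ an all-ones vector. A point-pencil of $\mathcal{P}$ with vertex a point $P$ of $\mathcal{P}$ is the set of all generators of $\mathcal{P}$ containing $P$. An embedded polar space of rank $d-1$ and parameter $e+2$ inside $\mathcal{P}'$ is a polar space of this rank and parameter over $\mathbb{F}_q$ arising as the intersection of $\mathcal{P}'$ with a hyperplane of $\alpha$; this is only possible for $e=0$, where it is a $\mathcal{Q}^-(2d-1,q)$ in $\mathcal{P}'=\mathcal{Q}(2d,q)$ (for $d=2$ it has rank 1 and its generators are the points of an elliptic quadric $\mathcal{Q}^-(3,q)$). For a polar space of rank $d$, let $C_{a,b}:\mathbb{R}^{\Omega_a}\to\mathbb{R}^{\Omega_b}$ be the incidence map (matrix with rows indexed by $b$-spaces, columns by $a$-spaces, entry 1 if one contains the other, 0 otherwise; $C_{a,b}=0$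 if $a$ or $b$ is not in $\{0,\dots,d\}$). For $0\le r\le a$, $0\le i\le\min(r,d-a)$ put $V^a_{r,i}=\mathrm{Im}(C_{r,a})\cap\mathrm{Im}(C_{r-1,a})^\perp\cap\mathrm{Im}(C_{d-i,a})\cap\mathrm{Im}(C_{d-i+1,a})^\perp$; then $V^a_{0,0}=\langle\boldsymbol{j}\rangle$ and $\mathbb{R}^{\Omega_a}$ is the orthogonal direct sum of the $V^a_{r,i}$. In the polar space $\mathcal{P}'$ (rank $d$), a set $\mathcal{M}\subseteq\Omega_{d-1}$ is an $(m,d-1)$-ovoid if every generator of $\mathcal{P}'$ contains exactly $m$ elements of $\mathcal{M}$; it is trivial if it is $\emptyset$ or $\Omega_{d-1}$. It is regular if there are constants $c_1,c_2$ such that for each $\pi\in\Omega_{d-1}$ the number of $\rho\in\mathcal{M}$ with $\dim(\rho\cap\pi)=d-2$ and $\langle\rho,\pi\rangle$ not a generator of $\mathcal{P}'$ equals $c_1$ if $\pi\in\mathcal{M}$ and $c_2$ if $\pi\notin\mathcal{M}$. A non-trivial regular $(m,d-1)$-ovoid has type $r$ if its characteristic vector lies in $V^{d-1}_{0,0}\oplus V^{d-1}_{r,1}$ (computed in $\mathcal{P}'$). *)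

(* Defs.v *)
From HB Require Import structures.
From mathcomp Require Import all_boot all_order all_algebra.
From mathcomp Require Import sesquilinear.
From mathcomp Require Import reals.

Set Implicit Arguments.
Unset Strict Implicit.
Unset Printing Implicit Defensive.

Import Order.TTheory GRing.Theory Num.Theory.
Local Open Scope ring_scope.

HB.instance Definition _ (F : finFieldType) (V : vectType F) :=
  CanIsCountable (@VectorInternalTheory.vs2mxK F V).
HB.instance Definition _ (F : finFieldType) (V : vectType F) : isFinite {vspace V} :=
  CanIsFinite (@VectorInternalTheory.vs2mxK F V).

Record quadratic_form (F : fieldType) (V : lmodType F) := QuadraticForm {
  qform :> V -> F;
  qpolar : {biscalar V};
  qformZ : forall (a : F) (v : V), qform (a *: v) = a ^+ 2 * qform v;
  qformD : forall u v : V, qform (u + v) = qform u + qform v + qpolar u v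
}.

Inductive classical_form (F : fieldType) (V : lmodType F) : Type :=
| Quadratic (Q : quadratic_form V)
| Hermitian (theta : involutive_rmorphism F) (h : {hermitian_sym V for theta})
    of exists x : F, theta x != x
| Symplectic (b : {biscalar V}) of forall v : V, b v v = 0.

(* The six families Q+(2D-1,q), H(2D-1,q), W(2D-1,q), Q(2D,q), H(2D,q) and
   Q-(2D+1,q), indexed by the rank D. *)
Inductive polar_type :=
  | HyperbolicQuadric
  | HermitianOdd
  | SymplecticSpace
  | ParabolicQuadric
  | HermitianEven
  | EllipticQuadric.

Definition parameter (t : polar_type) : rat :=
  match t with
  | HyperbolicQuadric => 0
  | HermitianOdd => 1 / 2
  | SymplecticSpace => 1
  | ParabolicQuadric => 1
  | HermitianEven => 3 / 2
  | EllipticQuadric => 2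
  end.

(* Vector space dimension, i.e. one more than the projective dimension. *)
Definition natural_dim (t : polar_type) (D : nat) : nat :=
  match t with
  | HyperbolicQuadric | HermitianOdd | SymplecticSpace => 2 * D
  | ParabolicQuadric | HermitianEven => 2 * D + 1
  | EllipticQuadric => 2 * D + 2
  end.

Definition form_matches (F : fieldType) (V : lmodType F)
    (phi : classical_form V) (t : polar_type) : bool :=
  match phi, t with
  | Quadratic _, (HyperbolicQuadric | ParabolicQuadric | EllipticQuadric)
  | Hermitian _ _ _, (HermitianOdd | HermitianEven)
  | Symplectic _ _, SymplecticSpace => true
  | _, _ => false
  end.

Definition pairing (F : fieldType) (V : lmodType F)
    (phi : classical_form V) : V -> V -> F :=
  match phi with
  | Quadratic Q => qpolar Q
  | Hermitian _ h _ => h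
  | Symplectic b _ => b
  end.

Definition singular (F : fieldType) (V : lmodType F)
    (phi : classical_form V) (v : V) : bool :=
  match phi with
  | Quadratic Q => Q v == 0
  | Hermitian _ h _ => h v v == 0
  | Symplectic b _ => b v v == 0
  end.

Section PolarSpaces.

Variables (F : finFieldType) (N : nat).
Local Notation V := 'rV[F]_N.
Variable phi : classical_form V.
Implicit Types (U W G A pi rho : {vspace V}) (M : {set {vspace V}}).

Definition totally_singular W : bool :=
  [forall u : V, forall v : V, (u \in W) ==> (v \in W) ==>
     singular phi u && (pairing phi u v == 0)].

(* In characteristic 2 the polar form of a parabolic quadric has a radical of
   dimension 1 on which the quadratic form does not vanish; hence only singular
   vectors of the radical are required to be 0.  In the Hermitian and symplectic
   cases every vector of the radical is singular. *)
Definition nondegenerate_on U : Prop :=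
  forall v, v \in U -> singular phi v ->
    (forall u, u \in U -> pairing phi u v = 0) -> v = 0.

(* The set of a-spaces of the polar space induced by phi on the subspace U. *)
Definition Omega U (a : nat) : {set {vspace V}} :=
  [set W | [&& (W <= U)%VS, totally_singular W & \dim W == a]].

Definition classical_polar_space U (t : polar_type) (D : nat) : Prop :=
  [/\ form_matches phi t,
      \dim U = natural_dim t D,
      nondegenerate_on U,
      exists G, G \in Omega U D
    & forall W, (W <= U)%VS -> totally_singular W -> (\dim W <= D)%N].

Definition point_pencil U (D : nat) (P : {vspace V}) : {set {vspace V}} :=
  [set G in Omega U D | (P <= G)%VS].

Definition ovoid U (d m : nat) M : Prop :=
  M \subset Omega U (d - 1) /\
  forall G, G \in Omega U d -> #|[set W in M | (W <= G)%VS]| = m.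

Definition trivial_ovoid U (d : nat) M : Prop :=
  M = set0 \/ M = Omega U (d - 1).

Definition regular U (d : nat) M : Prop :=
  exists c1 c2 : nat, forall pi, pi \in Omega U (d - 1) ->
    #|[set rho in M | (\dim (rho :&: pi)%VS == d - 2)%N
                      && ((rho + pi)%VS \notin Omega U d)]|
    = (if pi \in M then c1 else c2).

Variables (R : realType) (U : {vspace V}).

(* Vectors of R^(Omega_a) are row vectors and matrices act on the right, so this
   is the transpose of the matrix with rows indexed by b-spaces and columns by
   a-spaces, and Im(C_{a,b}) is the row space of [incidence a b].  For a or b
   larger than the rank it is an empty matrix. *)
Definition incidence (a b : nat) : 'M[R]_(#|Omega U a|, #|Omega U b|) :=
  \matrix_(i, j) ((enum_val i <= enum_val j)%VS
                  || (enum_val j <= enum_val i)%VS)%:R.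

(* Orthogonal complement of a row space for the standard inner product. *)
Definition orth (p k : nat) (A : 'M[R]_(p, k)) : 'M[R]_k := kermx A^T.

(* For r = 0 the image of C_{-1,a} = 0 is the zero subspace. *)
Definition Vspace (d a r i : nat) : 'M[R]_#|Omega U a| :=
  (incidence r a
   :&: (if r is s.+1 then orth (incidence s a) else orth (0 : 'M_(1, _)))
   :&: incidence (d - i) a
   :&: orth (incidence (d - i).+1 a))%MS.

Definition char_vec (a : nat) M : 'rV[R]_#|Omega U a| :=
  \row_i (enum_val i \in M)%:R.

Definition regular_ovoid_of_type (d m r : nat) M : Prop :=
  [/\ ovoid U d m M,
      ~ trivial_ovoid U d M,
      regular U d M
    & (char_vec (d - 1) M <= Vspace d (d - 1) 0 0 + Vspace d (d - 1) r 1)%MS].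

End PolarSpaces.

(* Main.v *)
(* Suppose that every generator through the point P meets alpha in an element
   of M, and let H be the intersection of alpha with the perp of P.  For a
   totally singular W in H, the space P + W extends to a generator, whose trace
   on alpha contains W and has dimension d-1.  So dim W <= d-1, and W is in M if
   dim W = d-1.  Hence H is a hyperplane of alpha without totally singular
   d-spaces.  It is nondegenerate: if v in H were singular and orthogonal to H,
   then H would be the perp of v in alpha, which contains a totally singular
   d-space through v.  If alpha is an elliptic quadric or a Hermitian space, then
   W^perp / W, for W a (d-1)-space of H, has dimension at least 3 or 2
   respectively, so it has an isotropic vector (a x^2 + b y^2 = c is solvable, or
   the norm is surjective) and H contains a d-space, a contradiction.  If alpha
   is a parabolic quadric, then H is an elliptic quadric of rank d-1, all of
   whose generators lie in M. *)
From HB Require Import structures.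
Require Import Defs.
From mathcomp Require Import all_boot all_order all_algebra.
From mathcomp Require Import sesquilinear.
From mathcomp Require Import reals.
From mathcomp Require Import ring zify.

Set Implicit Arguments.
Unset Strict Implicit.
Unset Printing Implicit Defensive.

Import Order.TTheory GRing.Theory Num.Theory.
Local Open Scope ring_scope.

(** * Equations over the fixed field of an automorphism *)

Section FiniteFieldEquations.

Variables (F : finFieldType) (theta : {rmorphism F -> F}).
(** The fixed field is all of [F] when [theta] is the identity, as used for quadrics, and a proper
    subfield when [theta] is the involution of a Hermitian form. *)
Local Notation K := [set x | theta x == x].
Local Notation squares := [set x ^+ 2 | x in K].

(** Only 0 squares to 0, and every other square has at most the two roots x and -x, so #|K| is at
    most 1 + 2 (#|squares| - 1). *)
Lemma card_fixed_squares : (#|K| < 2 * #|squares|)%N.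
Proof.
have K0 : 0 \in K by rewrite inE rmorph0.
have S0 : 0 \in squares by apply/imsetP; exists 0; rewrite ?expr0n.
rewrite -sum1_card (partition_big_imset (fun x : F => x ^+ 2)) /=.
rewrite (bigD1 0) //= (cardsD1 0 squares) S0.
rewrite (eq_bigl (pred1 0)); last first.
  move=> x; rewrite !inE sqrf_eq0 andbC; case: eqP => //= ->.
  by rewrite rmorph0 eqxx.
rewrite big_pred1_eq mulnDr muln1 addnC addn1 !ltnS.
rewrite -sum1_card big_distrr /=.
rewrite [leqRHS](eq_bigl (fun y => (y \in squares) && (y != 0))).
  apply: leq_sum => _ /andP[/imsetP[x _ ->] _].
  rewrite muln1 sum1dep_card -[in leqRHS](card_ord 2).
  apply: leq_trans (subset_leq_card (_ : _ \subset [set x; - x])) _.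
    by apply/subsetP => y; rewrite !inE eqf_sqr => /andP[_].
  by rewrite cards2 card_ord ltnS leq_b1.
by move=> y; rewrite !inE andbC.
Qed.

Lemma fixed_conic (a b c : F) : theta a = a -> theta b = b -> theta c = c ->
  a != 0 -> b != 0 ->
  exists x y, [/\ theta x = x, theta y = y & a * x ^+ 2 + b * y ^+ 2 = c].
Proof.
move=> ta tb tc a0 b0.
(* Pigeonhole: both sets have more than half the size of K. *)
pose A := [set a * s | s in squares]; pose B := [set c - b * s | s in squares].
have cA : #|A| = #|squares| by apply: card_imset; apply: mulfI.
have cB : #|B| = #|squares|.
  by apply: card_imset => s s' /addrI/oppr_inj/(mulfI b0).
have tK x : x \in K -> theta x = x by rewrite inE => /eqP.
have sAK : A :|: B \subset K.
  apply/subsetP => _ /setUP[] /imsetP[_ /imsetP[x /tK tx ->] ->]; rewrite inE.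
    by rewrite rmorphM rmorphXn /= ta tx.
  by rewrite rmorphB rmorphM rmorphXn /= tc tb tx.
have [AB0|[z /setIP[]]] := set_0Vmem (A :&: B).
  have := leq_ltn_trans (subset_leq_card sAK) card_fixed_squares.
  by rewrite cardsU AB0 cards0 subn0 cA cB addnn mul2n ltnn.
move=> /imsetP[_ /imsetP[x /tK tx ->] ->] /imsetP[_ /imsetP[y /tK ty ->] eq_xy].
by exists x, y; rewrite eq_xy subrK.
Qed.

(** In characteristic 2 squaring is additive, so a solution of x^2 + y^2 = c gives the root x +
    y. *)
Lemma fixed_sqrt_char2 (c : F) : 2%:R = 0 :> F -> theta c = c ->
  exists2 z, theta z = z & z ^+ 2 = c.
Proof.
move=> two0 tc; have t1 : theta 1 = 1 by rewrite rmorph1.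
have [x [y [tx ty <-]]] := fixed_conic t1 t1 tc (oner_neq0 _) (oner_neq0 _).
exists (x + y); first by rewrite rmorphD /= tx ty.
have -> : (x + y) ^+ 2 = 1 * x ^+ 2 + 1 * y ^+ 2 + 2%:R * (x * y) by ring.
by rewrite two0 mul0r addr0.
Qed.

Lemma norm_surj (c : F) : involutive theta -> (exists x, theta x != x) ->
  theta c = c -> exists z, z * theta z = c.
Proof.
move=> thetaK [x nx] tc; have [two0|two_neq0] := eqVneq (2%:R : F) 0.
  (* An element [z] fixed by [theta] has norm [z ^+ 2]. *)
  have [z tz <-] := fixed_sqrt_char2 two0 tc.
  by exists z; rewrite tz.
(* In odd characteristic [y + z * eps] with y, z fixed has norm
   [y ^+ 2 - eps ^+ 2 * z ^+ 2]. *)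
pose eps := x - theta x.
have teps : theta eps = - eps by rewrite rmorphB /= thetaK opprB.
have eps0 : eps != 0 by rewrite subr_eq0 eq_sym.
have t1 : theta 1 = 1 by rewrite rmorph1.
have tdelta : theta (- eps ^+ 2) = - eps ^+ 2.
  by rewrite rmorphN rmorphXn /= teps sqrrN.
have [||y [z [ty tz <-]]] := fixed_conic t1 tdelta tc.
- exact: oner_neq0.
- by rewrite oppr_eq0 expf_neq0.
exists (y + z * eps); rewrite rmorphD rmorphM /= ty tz teps; ring.
Qed.

End FiniteFieldEquations.

(** * Orthogonality and totally singular subspaces *)

Section Forms.

Variables (F : finFieldType) (N : nat).
Local Notation V := 'rV[F]_N.

Lemma qpolarC (Q : quadratic_form V) u v : qpolar Q u v = qpolar Q v u.
Proof.
have := qformD Q u v; rewrite addrC qformD [Q v + Q u]addrC.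
by move/addrI.
Qed.

Lemma qpolar_diag (Q : quadratic_form V) v : qpolar Q v v = 2%:R * Q v.
Proof.
have := qformD Q v v; rewrite -mulr2n -scaler_nat qformZ => e.
have -> : qpolar Q v v = (Q v + Q v + qpolar Q v v) - 2%:R * Q v by ring.
by rewrite -e; ring.
Qed.

Variable phi : classical_form V.
Implicit Types (u v w : V) (A B G U W : {vspace V}).

Lemma pairingDl u v w :
  pairing phi (u + v) w = pairing phi u w + pairing phi v w.
Proof. by case: phi => [Q|th h _|b _] /=; rewrite linearDl. Qed.

Lemma pairingDr u v w :
  pairing phi u (v + w) = pairing phi u v + pairing phi u w.
Proof. by case: phi => [Q|th h _|b _] /=; rewrite linearDr. Qed.

Lemma pairingZl a u v : pairing phi (a *: u) v = a * pairing phi u v.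
Proof. by case: phi => [Q|th h _|b _] /=; rewrite linearZl_LR. Qed.

Lemma pairing_eq0C u v : pairing phi u v = 0 -> pairing phi v u = 0.
Proof.
case: phi => [Q|th h _|b bK] /=.
- by rewrite qpolarC.
- by move=> e; rewrite hermC e rmorph0 mulr0.
- move=> e; have := bK (u + v).
  by rewrite linearDl !linearDr /= !bK e !add0r addr0.
Qed.

Lemma singularZ a v : singular phi v -> singular phi (a *: v).
Proof.
case: phi => [Q|th h _|b _] /= /eqP e.
- by rewrite qformZ e mulr0.
- by rewrite linearZl_LR /= linearZr_LR /= e !mulr0.
- by rewrite linearZl_LR /= linearZr_LR /= e !mulr0.
Qed.

Lemma singularD u v : singular phi u -> singular phi v ->
  pairing phi u v = 0 -> singular phi (u + v).
Proof.
move=> su sv uv; have := pairing_eq0C uv.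
move: su sv uv; case: phi => [Q|th h _|b _] /= /eqP eu /eqP ev uv vu.
- by rewrite qformD eu ev uv !addr0.
- by rewrite linearDl !linearDr /= eu ev uv vu !addr0.
- by rewrite linearDl !linearDr /= eu ev uv vu !addr0.
Qed.

(** The pairing is linear in its first argument, even for a Hermitian form, so [perp W] can be the
    kernel of a linear map into a space of dimension [\dim W]. This target dimension bounds the
    codimension of the perp. *)
Definition pairings W u : 'rV[F]_(\dim W) :=
  \row_i pairing phi u (vbasis W)`_i.

Fact pairings_linear W : linear (pairings W).
Proof.
by move=> a u v; apply/rowP => i; rewrite !mxE pairingDl pairingZl.
Qed.

HB.instance Definition _ W :=
  GRing.isLinear.Build F V 'rV[F]_(\dim W) _ (pairings W) (pairings_linear W).

Definition perp W : {vspace V} := lker (linfun (pairings W)).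

Lemma perpP W u :
  reflect (forall w, w \in W -> pairing phi u w = 0) (u \in perp W).
Proof.
rewrite memv_ker lfunE; apply: (iffP eqP) => [/rowP u0 w Ww|u0].
  apply: pairing_eq0C; rewrite (coord_vbasis Ww).
  elim/big_rec: _ => [|i x _ IH].
    by rewrite -(scale0r 0) pairingZl mul0r.
  rewrite pairingDl pairingZl IH addr0 [pairing _ _ _]pairing_eq0C ?mulr0 //.
  by have := u0 i; rewrite !mxE.
by apply/rowP => i; rewrite !mxE u0 // vbasis_mem // mem_nth ?size_tuple.
Qed.

Lemma sub_perpC A B : (A <= perp B)%VS -> (B <= perp A)%VS.
Proof.
move=> /subvP AB; apply/subvP => b Bb; apply/perpP => a /AB/perpP a_perp.
exact/pairing_eq0C/a_perp.
Qed.

Lemma perpS A B : (A <= B)%VS -> (perp B <= perp A)%VS.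
Proof.
move=> /subvP AB; apply/subvP => u /perpP uB.
by apply/perpP => a /AB/uB.
Qed.

Lemma dim_cap_perp U W : (\dim U <= \dim (U :&: perp W) + \dim W)%N.
Proof.
rewrite -{1}(limg_ker_dim (linfun (pairings W)) U) leq_add2l.
by rewrite (leq_trans (dimvS (subvf _))) // dimvf /dim /= mul1n.
Qed.

Lemma tsP W : reflect
  ((forall v, v \in W -> singular phi v) /\ (W <= perp W)%VS)
  (totally_singular phi W).
Proof.
apply: (iffP forallP) => [ts | [sW /subvP WW] u].
  have ts' u v : u \in W -> v \in W -> singular phi u && (pairing phi u v == 0).
    by move=> Wu Wv; have /forallP/(_ v) := ts u; rewrite Wu Wv.
  split=> [v Wv|]; first by case/andP: (ts' v v Wv Wv).
  apply/subvP => u Wu; apply/perpP => v Wv.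
  by case/andP: (ts' u v Wu Wv) => _ /eqP.
apply/forallP => v; apply/implyP => Wu; apply/implyP => Wv.
by rewrite sW //=; have /perpP/(_ v Wv)-> := WW u Wu.
Qed.

Lemma ts_sub A B :
  (A <= B)%VS -> totally_singular phi B -> totally_singular phi A.
Proof.
move=> /subvP AB /tsP[sB /subvP BB]; apply/tsP; split=> [v /AB/sB //|].
by apply/subvP => u /AB/BB/perpP uB; apply/perpP => v /AB/uB.
Qed.

Lemma ts_add A B : totally_singular phi A -> totally_singular phi B ->
  (B <= perp A)%VS -> totally_singular phi (A + B).
Proof.
move=> /tsP[sA /subvP AA] /tsP[sB /subvP BB] BpA.
have /subvP ApB := sub_perpC BpA; move/subvP in BpA.
apply/tsP; split=> [_ /memv_addP[a Aa [b Bb ->]]|].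
  by apply: singularD (sA a Aa) (sB b Bb) _; have /perpP-> := ApB a Aa.
apply/subvP => _ /memv_addP[a Aa [b Bb ->]].
have /perpP aA := AA a Aa; have /perpP bB := BB b Bb.
apply/perpP => _ /memv_addP[a' Aa' [b' Bb' ->]].
have /perpP aB := ApB a Aa; have /perpP bA := BpA b Bb.
by rewrite pairingDl !pairingDr aA // aB // bA // bB // !addr0.
Qed.

Lemma singular_pairing v : singular phi v -> pairing phi v v = 0.
Proof.
case: phi => [Q|th h _|b _] /= /eqP e //.
by rewrite qpolar_diag e mulr0.
Qed.

Lemma ts_line v : singular phi v -> totally_singular phi <[v]>.
Proof.
move=> sv; have vv := singular_pairing sv; apply/tsP; split.
  by move=> _ /vlineP[a ->]; apply: singularZ.
apply/subvP => _ /vlineP[a ->]; apply/perpP => _ /vlineP[b ->].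
by rewrite pairingZl [pairing _ _ _]pairing_eq0C ?mulr0 // pairingZl vv mulr0.
Qed.

(** The extension is [W] plus the part of the given [G] orthogonal to [W]. A dimension count shows
    that it has dimension at least [D], and maximality gives equality. *)
Lemma ts_extend U D G W : G \in Omega phi U D -> (W <= U)%VS ->
  totally_singular phi W ->
  (forall W', (W' <= U)%VS -> totally_singular phi W' -> (\dim W' <= D)%N) ->
  exists2 G', G' \in Omega phi U D & (W <= G')%VS.
Proof.
rewrite inE => /and3P[GU tG /eqP dG] WU tW maxD.
(* Only a complement of W :&: G in W imposes conditions on vectors of G. *)
pose W' := (W :\: G)%VS; pose G0 := (G :&: perp W')%VS.
have /tsP[_ GpG] := tG.
have G0W : (G0 <= perp W)%VS.
  apply/sub_perpC; rewrite -(addv_diff_cap W G) subv_add sub_perpC ?capvSr //=.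
  by rewrite (subv_trans (capvSr _ _)) // (subv_trans GpG) // perpS ?capvSl.
have tWG : totally_singular phi (W + G0).
  by apply: ts_add => //; apply: ts_sub tG; apply: capvSl.
have sWG : (W + G0 <= U)%VS by rewrite subv_add WU (subv_trans (capvSl _ _)).
exists (W + G0)%VS; last exact: addvSl.
rewrite inE sWG tWG eqn_leq maxD //=.
have := dimv_sum_cap W G0; have := dimv_cap_compl W G.
have := dim_cap_perp G W'.
have : (\dim (W :&: G0) <= \dim (W :&: G))%N.
  by rewrite dimvS // capvS // capvSl.
rewrite -/W' -/G0 dG; lia.
Qed.

End Forms.

(** * Existence of isotropic vectors *)

Section IsotropicVectors.

Variables (F : finFieldType) (N : nat).
Local Notation V := 'rV[F]_N.
Implicit Types (X U W : {vspace V}).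

Lemma exists_nonzero X : (0 < \dim X)%N -> exists2 v, v \in X & v != 0.
Proof.
by rewrite lt0n dimv_eq0 => X0; exists (vpick X); rewrite ?memv_pick ?vpick0.
Qed.

(** For orthogonal nonsingular u and v, the vector a u + v is singular once the norm of a is
    -h(v,v)/h(u,u). *)
Lemma hermitian_isotropic (theta : involutive_rmorphism F)
  (h : {hermitian_sym V for theta}) (nt : exists x, theta x != x) X :
  let phi := Defs.Hermitian h nt in (1 < \dim X)%N ->
  exists v, [/\ v \in X, v != 0 & singular phi v].
Proof.
move=> phi dX.
have [u uX u0] : exists2 u, u \in X & u != 0 by apply: exists_nonzero; lia.
have [su|su] := boolP (singular phi u); first by exists u.
have [v] : exists2 v, v \in (X :&: perp phi <[u]>)%VS & v != 0.
  apply: exists_nonzero; have := dim_cap_perp phi X <[u]>.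
  by rewrite dim_vline u0; lia.
rewrite memv_cap => /andP[vX /perpP/(_ u (memv_line u)) /= vu] v0.
have [sv|sv] := boolP (singular phi v); first by exists v.
rewrite /= in su sv; have uv : h u v = 0 by apply: (@pairing_eq0C _ _ phi).
(* Hence the required norm lies in the fixed field of [theta]. *)
have fixed w : theta (h w w) = h w w by rewrite [RHS]hermC expr0 mul1r.
have [|a ha] := @norm_surj _ theta (- h v v / h u u) (rmorphK theta) nt.
  by rewrite rmorphM rmorphN fmorphV /= !fixed.
have sauv : h (a *: u + v) (a *: u + v) = 0.
  rewrite linearDl !linearDr /= !linearZl_LR /= !linearZr_LR /= uv vu.
  by rewrite !mulr0 addr0 add0r mulrA ha divfK // addNr.
exists (a *: u + v); split; first by rewrite memvD ?memvZ.
(* If a u + v = 0, then v is a multiple of u, and u is orthogonal to v, so v would be singular. *)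
- apply: contra_neq sv => /eqP; rewrite addrC addr_eq0 => /eqP v_au.
  by rewrite {1}v_au linearNl linearZl_LR /= uv mulr0 oppr0.
- exact/eqP.
Qed.

(** In odd characteristic three pairwise orthogonal vectors reduce the claim to a conic. In
    characteristic 2 two orthogonal independent vectors suffice, because every element is a
    square. *)
Lemma quadratic_isotropic (Q : quadratic_form V) X : (2 < \dim X)%N ->
  exists v, [/\ v \in X, v != 0 & Q v == 0].
Proof.
set phi := Quadratic Q => dX.
have [u uX u0] : exists2 u, u \in X & u != 0 by apply: exists_nonzero; lia.
have [su|su] := eqVneq (Q u) 0; first by exists u; rewrite su.
have dY : (1 < \dim (X :&: perp phi <[u]>))%N.
  by have := dim_cap_perp phi X <[u]>; rewrite dim_vline u0; lia.
have pZl a x y : qpolar Q (a *: x) y = a * qpolar Q x y.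
  exact: (pairingZl phi).
have pDl x y z : qpolar Q (x + y) z = qpolar Q x z + qpolar Q y z.
  exact: (pairingDl phi).
have QZD a b x y : qpolar Q x y = 0 ->
    Q (a *: x + b *: y) = Q x * a ^+ 2 + Q y * b ^+ 2.
  move=> xy; rewrite qformD !qformZ pZl qpolarC pZl qpolarC xy.
  by rewrite !mulr0 addr0 [Q x * _]mulrC [Q y * _]mulrC.
have [two0|two_neq0] := eqVneq (2%:R : F) 0.
  (* Here u is orthogonal to itself, so v is taken outside the line of u to ensure independence. *)
  have [v] : exists2 v, v \in (X :&: perp phi <[u]> :\: <[u]>)%VS & v != 0.
    apply: exists_nonzero; have := dimv_cap_compl (X :&: perp phi <[u]>) <[u]>.
    have := dimvS (capvSr (X :&: perp phi <[u]>) <[u]>).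
    by rewrite dim_vline u0; lia.
  move=> vD v0; have /subvP/(_ v vD) := diffvSl (X :&: perp phi <[u]>) <[u]>.
  rewrite memv_cap => /andP[vX /perpP/(_ u (memv_line u)) /= vu].
  have vNu : v \notin <[u]>%VS.
    apply: contraNN v0 => vu'.
    by rewrite -memv0 -(capv_diff (X :&: perp phi <[u]>) <[u]>) memv_cap vD.
  have [z _ hz] := @fixed_sqrt_char2 _ idfun (- Q v / Q u) two0 erefl.
  exists (z *: u + 1 *: v); split.
  - by rewrite memvD ?memvZ.
  - apply: contraNneq vNu => /eqP; rewrite scale1r addrC addr_eq0 => /eqP->.
    by rewrite rpredN memvZ ?memv_line.
  - rewrite QZD; last by rewrite qpolarC.
    by rewrite hz expr1n mulr1 mulrC divfK // addNr.
have [v] : exists2 v, v \in (X :&: perp phi <[u]>)%VS & v != 0.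
  by apply: exists_nonzero; lia.
rewrite memv_cap => /andP[vX /perpP/(_ u (memv_line u)) /= vu] v0.
have [sv|sv] := eqVneq (Q v) 0; first by exists v; rewrite sv.
have [w] : exists2 w,
    w \in (X :&: perp phi <[u]> :&: perp phi <[v]>)%VS & w != 0.
  apply: exists_nonzero; have := dim_cap_perp phi (X :&: perp phi <[u]>) <[v]>.
  by rewrite dim_vline v0; lia.
rewrite !memv_cap => /andP[/andP[wX /perpP/(_ u (memv_line u)) /= wu]].
move=> /perpP/(_ v (memv_line v)) /= wv w0.
have [sw|sw] := eqVneq (Q w) 0; first by exists w; rewrite sw.
have [a [b [_ _ hab]]] :=
  @fixed_conic _ idfun _ _ (- Q w) erefl erefl erefl su sv.
have w_perp : qpolar Q w (a *: u + b *: v) = 0.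
  rewrite qpolarC pDl !pZl.
  by rewrite !(qpolarC _ _ w) wu wv !mulr0 addr0.
exists (a *: u + b *: v + w); split.
- by rewrite !memvD ?memvZ.
(* If the sum vanishes, then w is orthogonal to itself, so 2 Q(w) = 0 and w is singular. *)
- apply: contra_neq sw => /eqP; rewrite addrC addr_eq0 => /eqP we.
  have: 2%:R * Q w == 0.
    rewrite -qpolar_diag {2}we -scaleN1r qpolarC pZl qpolarC.
    by rewrite w_perp mulr0.
  by rewrite mulf_eq0 (negPf two_neq0) => /eqP.
- rewrite qformD [qpolar _ _ _]qpolarC w_perp QZD; last by rewrite qpolarC.
  by rewrite hab addr0 addNr.
Qed.

(** The complement [X] of [W] in its perp within [U] stands in for the quotient of the perp by [W].
    Its dimension is at least [\dim U] - 2 [\dim W], hence at least [k]. *)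
Lemma ts_enlarge (phi : classical_form V) k W U :
  (forall X, (k <= \dim X)%N ->
     exists v, [/\ v \in X, v != 0 & singular phi v]) ->
  (W <= U)%VS -> totally_singular phi W -> (\dim W + \dim W + k <= \dim U)%N ->
  exists W', [/\ (W' <= U)%VS, totally_singular phi W' & \dim W' = (\dim W).+1].
Proof.
move=> iso WU tW dU; pose X := ((U :&: perp phi W) :\: W)%VS.
have [v [vX v0 sv]] : exists v, [/\ v \in X, v != 0 & singular phi v].
  apply: iso; have := dim_cap_perp phi U W.
  have := dimv_cap_compl (U :&: perp phi W) W; rewrite -/X.
  by have := dimvS (capvSr (U :&: perp phi W) W); lia.
have /subvP/(_ v vX) := diffvSl (U :&: perp phi W) W.
rewrite memv_cap => /andP[vU vW]; exists (W + <[v]>)%VS; split.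
- by rewrite subv_add WU -memvE.
- by apply: ts_add => //; rewrite ?ts_line // -memvE.
- rewrite dimv_disjoint_sum ?dim_vline ?v0 ?addn1 //.
  apply/eqP; rewrite -subv0 -(capv_diff (U :&: perp phi W) W) capvC.
  by rewrite capvS // -memvE.
Qed.

End IsotropicVectors.

(** * The section by the perp of a point *)

Section Hyperplanes.

Variables (F : finFieldType) (N : nat).
Local Notation V := 'rV[F]_N.
Variable phi : classical_form V.
Implicit Types (P U W : {vspace V}).

Lemma point_pencil_traces D k U P (M : {set {vspace V}}) :
  (exists G, G \in Omega phi fullv D) ->
  (forall W, totally_singular phi W -> (\dim W <= D)%N) ->
  totally_singular phi P ->
  point_pencil phi fullv D P
    \subset [set G in Omega phi fullv D |
               (\dim (G :&: U)%VS == k) && ((G :&: U)%VS \in M)] ->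
  forall W, (W <= U :&: perp phi P)%VS -> totally_singular phi W ->
    (\dim W <= k)%N /\ (\dim W = k -> W \in M).
Proof.
move=> [G OG] maxD tP /subsetP pencil W; rewrite subv_cap => /andP[WU WP] tW.
have tPW := ts_add tP tW WP.
have [|G' OG' sG'] := ts_extend OG (subvf (P + W)) tPW.
  by move=> *; apply: maxD.
move: sG'; rewrite subv_add => /andP[PG' WG'].
have /pencil : G' \in point_pencil phi fullv D P by rewrite inE OG'.
rewrite inE OG' /= => /andP[/eqP dG' MG'].
have WGU : (W <= G' :&: U)%VS by rewrite subv_cap WG'.
split=> [|dW]; first by rewrite -dG' dimvS.
by have /eqP -> : W == (G' :&: U)%VS by rewrite eqEdim WGU dW dG' /=.
Qed.

Lemma perp_section U P D :
  (exists G, G \in Omega phi U D) ->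
  (forall W, (W <= U)%VS -> totally_singular phi W -> (\dim W <= D)%N) ->
  nondegenerate_on phi U -> \dim P = 1%N -> (0 < D)%N ->
  (forall W, (W <= U :&: perp phi P)%VS -> totally_singular phi W ->
     (\dim W <= D - 1)%N) ->
  [/\ (\dim (U :&: perp phi P)).+1 = \dim U,
      nondegenerate_on phi (U :&: perp phi P)%VS
    & exists G, G \in Omega phi (U :&: perp phi P)%VS (D - 1)].
Proof.
set H := (U :&: perp phi P)%VS => - [G OG] maxD ndU dP D0 maxH.
have HU : (H <= U)%VS by apply: capvSl.
have := OG; rewrite inE => /and3P[GU tG /eqP dG].
(* If H were all of U, it would contain the D-space G, against [maxH]. *)
have HsubU : (\dim H < \dim U)%N.
  rewrite ltn_neqAle dimvS // andbT; apply/eqP => dH.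
  have /eqP eHU : H == U by rewrite eqEdim HU dH /=.
  by have := maxH G; rewrite eHU GU dG => /(_ isT tG); lia.
have dH : (\dim H).+1 = \dim U.
  by have := dim_cap_perp phi U P; rewrite -/H dP; lia.
split=> //.
- move=> v vH sv v_rad; apply/eqP/negPn/negP => v0.
    have Hv : (H <= perp phi <[v]>)%VS.
    apply/sub_perpC; rewrite -memvE; apply/perpP => u uH.
    exact/pairing_eq0C/v_rad.
  (* The perp of v in U contains the hyperplane H, and it is not all of U because U is
     nondegenerate. *)
  have eH : (U :&: perp phi <[v]>)%VS = H.
    apply/esym/eqP; rewrite eqEdim subv_cap HU Hv /= -ltnS dH.
    rewrite ltn_neqAle dimvS ?capvSl // andbT; apply/eqP => dUv.
    have /eqP eUv : (U :&: perp phi <[v]>)%VS == U.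
      by rewrite eqEdim capvSl dUv /=.
    case/eqP: v0; apply: ndU sv _ => [|u]; first exact: (subvP HU).
    rewrite -eUv memv_cap => /andP[_ /perpP].
    by apply; apply: memv_line.
  have vU : (<[v]> <= U)%VS by rewrite -memvE (subvP HU).
  (* A D-space through v lies in the perp of v, hence in H, where it is too large. *)
  have [G' OG' vG'] := ts_extend OG vU (ts_line sv) maxD.
  move: OG'; rewrite inE => /and3P[G'U tG' /eqP dG'].
  have /tsP[_ G'G'] := tG'.
  have := maxH G'; rewrite -eH subv_cap G'U (subv_trans G'G') ?perpS // dG'.
  by move=> /(_ isT tG'); rewrite leqNgt subn1 ltn_predL D0.
- have sGH : (G :&: perp phi P <= H)%VS by rewrite capvS.
  have tGP : totally_singular phi (G :&: perp phi P).
    by apply: ts_sub tG; apply: capvSl.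
  exists (G :&: perp phi P)%VS; rewrite inE sGH tGP eqn_leq maxH //=.
  by have := dim_cap_perp phi G P; rewrite dG dP; lia.
Qed.

End Hyperplanes.

Theorem theorem6p4 (R : realType) (F : finFieldType) (n d m : nat)
  (phi : classical_form 'rV[F]_(n + 4)) (t t' : polar_type)
  (alpha : {vspace 'rV[F]_(n + 4)}) (M : {set {vspace 'rV[F]_(n + 4)}}) :
  (2 <= d)%N ->
  classical_polar_space phi fullv t (d + 2) ->
  parameter t <= 1 ->
  \dim alpha = (n + 1)%N ->
  classical_polar_space phi alpha t' d ->
  parameter t' = parameter t + 1 ->
  regular_ovoid_of_type phi R alpha d m 1 M ->
  (forall (H : {vspace 'rV[F]_(n + 4)}) (t'' : polar_type),
     (H <= alpha)%VS -> \dim H = n ->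
     classical_polar_space phi H t'' (d - 1) ->
     parameter t'' = parameter t + 2 ->
     ~ (Omega phi H (d - 1) \subset M)) ->
  forall P : {vspace 'rV[F]_(n + 4)}, P \in Omega phi fullv 1 ->
    ~ (point_pencil phi fullv (d + 2) P
         \subset [set G in Omega phi fullv (d + 2) |
                    (\dim (G :&: alpha)%VS == d - 1)%N
                    && ((G :&: alpha)%VS \in M)]).
Proof.
move=> d2 [match_t _ _ exG maxG] t1 dalpha.
move=> [match_t' dalpha' nd exG' maxG'] tt' _ noH P.
rewrite inE => /and3P[_ tP /eqP dP] pencil.
have traces := point_pencil_traces exG (fun W => maxG W (subvf W)) tP pencil.
have maxH W WH tW := (traces W WH tW).1.
have [|dH ndH exH] := perp_section exG' maxG' nd dP _ maxH; first by lia.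
set H := (alpha :&: perp phi P)%VS in traces maxH dH ndH exH.
have {}dH : \dim H = n by move: dH; rewrite dalpha addn1 => -[].
have OH : Omega phi H (d - 1) \subset M.
  apply/subsetP => W; rewrite inE => /and3P[WH tW /eqP dW].
  exact: (traces W WH tW).2.
rewrite dalpha in dalpha'.
(* With W of dimension d-1 in H, the excess k = n - 2(d-1) is what remains for the quotient of the
   perp by W; an isotropic vector there would give a d-space in H. *)
have no_isotropic k : (n = 2 * d - 2 + k)%N ->
    ~ forall X, (k <= \dim X)%N ->
        exists v, [/\ v \in X, v != 0 & singular phi v].
  move=> nk iso; have [W] := exH; rewrite inE => /and3P[WH tW /eqP dW].
  have [|W' [W'H tW' dW']] := ts_enlarge iso WH tW; first by rewrite dW dH; lia.
  by have := maxH W' W'H tW'; lia.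
have HU : (H <= alpha)%VS := capvSl _ _.
clearbody H; clear exG maxG exG' maxG' nd tP pencil traces.
case: phi match_t match_t' noH maxH ndH exH OH no_isotropic.
- move=> Q match_t match_t' noH maxH ndH exH OH no_isotropic.
  (* The parameters leave a parabolic section of a hyperbolic quadric, where H has dimension n =
     2(d-1) + 2 and is elliptic, and an elliptic section of a parabolic quadric, where n = 2d + 1
     and k = 3. *)
  case: t match_t t1 tt' noH => // _ _ tt' noH;
    case: t' match_t' dalpha' tt' => //= _ nd _.
    apply: (noH H EllipticQuadric) => //; split=> //.
    by rewrite dH /=; lia.
  apply: (no_isotropic 3); first by lia.
  exact: quadratic_isotropic.
- move=> theta h nt match_t match_t' noH maxH ndH exH OH no_isotropic.
  case: t match_t t1 tt' noH => // _ _ tt' noH;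
    case: t' match_t' dalpha' tt' => //= _ nd _.
  (* Only [HermitianEven] remains for [t'], with n = 2d. *)
  apply: (no_isotropic 2); first by lia.
  exact: hermitian_isotropic.
- move=> b bK match_t match_t' _ _ _ _ _ _.
  (* Both spaces would be symplectic with parameter 1, against [tt']. *)
  by case: t match_t tt' {t1} => // _; case: t' match_t' {dalpha'}.
Qed.
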